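(* Let $\mathcal{H}$ be the class of graphs consisting of all complete multipartite graphs, all even cycles, and all paths. Let $F$ be a bipartite graph and let $H$ be an $\mathcal{H}$-blow-up of $F$. Then for every integer $q\ge 2$, \[ \hom(H,K_q)^2\le \hom(H\times K_2,K_q). \]
   Context: $\hom(H,G)$ denotes the number of graph homomorphisms from $H$ to $G$ (vertex maps sending edges to edges); $K_q$ is the loopless complete graph on $q$ vertices, so $\hom(H,K_q)$ is the number of proper $q$-colourings of $H$. The tensor product $H\times K_2$ has vertex set $V(H)\times\{1,2\}$, with $(u,i)$ adjacent to $(v,j)$ iff $uv\in E(H)$ and $i\neq j$. For a class $\mathcal{H}$ of graphs and a graph $F$ on vertices $v_1,\dots,v_k$, an $\mathcal{H}$-blow-up of $F$ is obtained by choosing $H_1,\dots,H_k\in\mathcal{H}$, taking the disjoint union of $H_1,\dots,H_k$ (replacing $v_i$ by $H_i$), and adding all edges between $V(H_i)$ and $V(H_j)$ (a complete bipartite graph $K_{|V(H_i)|,|V(H_j)|}$) whenever $v_iv_j\in E(F)$. Complete $1$-partite graphs are edgeless graphs, so in particular $K_1$ belongs to $\mathcal{H}$. *)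

(* Defs.v *)
From mathcomp Require Import all_boot.
Set Implicit Arguments. Unset Strict Implicit. Unset Printing Implicit Defensive.

Record graph := Graph { gV : finType; gadj : rel gV }.
Arguments gadj : clear implicits.

Definition simple (G : graph) : Prop :=
  symmetric (gadj G) /\ irreflexive (gadj G).

Definition bipartite (G : graph) : Prop :=
  exists side : gV G -> bool,
    forall u v, gadj G u v -> side u != side v.

Definition hom (H G : graph) : nat :=
  #|[set f : {ffun gV H -> gV G} |
      [forall u, forall v, gadj H u v ==> gadj G (f u) (f v)]]|.

Definition K (q : nat) : graph := @Graph 'I_q (fun i j => i != j).

Definition tensorK2 (H : graph) : graph :=
  @Graph (prod (gV H) bool) (fun a b => gadj H a.1 b.1 && (a.2 != b.2)).

Definition isomorphic (G G' : graph) : Prop :=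
  exists f : gV G -> gV G', bijective f /\
    forall u v, gadj G u v = gadj G' (f u) (f v).

Definition path_graph (n : nat) : graph :=
  @Graph 'I_n (fun i j => (i.+1 == j :> nat) || (j.+1 == i :> nat)).

Definition cycle_graph (n : nat) : graph :=
  @Graph 'I_n (fun i j => (i.+1 %% n == j :> nat) || (j.+1 %% n == i :> nat)).

Definition complete_multipartite (G : graph) : Prop :=
  0 < #|gV G| /\ exists c : gV G -> nat, forall u v, gadj G u v = (c u != c v).

Definition in_classH (G : graph) : Prop :=
  complete_multipartite G \/
  (exists m, 2 <= m /\ isomorphic G (cycle_graph (2 * m))) \/
  (exists n, 1 <= n /\ isomorphic G (path_graph n)).

Definition blowup_adj (F : graph) (Hs : gV F -> graph)
  (u v : {i : gV F & gV (Hs i)}) : bool :=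
  ((tag u == tag v) && gadj (Hs (tag u)) (tagged u) (tagged_as u v))
  || gadj F (tag u) (tag v).

Definition blowup (F : graph) (Hs : gV F -> graph) : graph :=
  @Graph {i : gV F & gV (Hs i)} (@blowup_adj F Hs).

(* Main.v *)
Require Import Defs.
From mathcomp Require Import all_boot zify.
Set Implicit Arguments. Unset Strict Implicit. Unset Printing Implicit Defensive.

(** Exchanging the two copies in the tensor product over one side of [F], both
sides of the inequality count pairs [(f, g)] of colourings of the blow-up that
are proper along the edges of [F]; inside each [H_i] one requires [f] and [g]
proper (straight) on the left, and [f u <> g v] for adjacent [u, v] (crossed) on
the right. The parts are switched from straight to crossed one at a time: once
everything outside [H_i] is fixed, this is the inequality
[P_H(S) P_H(T) <= #{crossed pairs H -> S x T}] for two lists of colours [S, T].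
For paths a greedy count suffices. For even cycles the right-hand side is a
product of two traces of powers of [k J + I]. For complete multipartite graphs
one adds a part at a time, using that the number of colourings is a log-concave
function of the number of colours, which follows because binomial convolution
preserves log-concavity. *)

(** * Log-concave sequences *)

Lemma rearr p p' g g' : p <= p' -> g <= g' -> p * g' + p' * g <= p * g + p' * g'.
Proof. by move=> /subnKC <- /subnKC <-; nia. Qed.

(** Symmetrising over pairs (i, j) doubles each side, and at one pair the difference of the terms is
    (n_j m_i - n_i m_j)(a_j b_i - a_i b_j), a product of two factors of the same sign. *)
Lemma chebyshev_sum (B : nat) (n m a b : nat -> nat) :
  (forall j i, j < i < B -> n i * m j <= n j * m i) ->
  (forall j i, j < i < B -> a i * b j <= b i * a j) ->
  (\sum_(i < B) n i * b i) * (\sum_(i < B) m i * a i)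
    <= (\sum_(i < B) n i * a i) * (\sum_(i < B) m i * b i).
Proof.
move=> nm ab.
have D (f g : nat -> nat) : ((\sum_(i < B) f i) * (\sum_(i < B) g i)).*2 =
    \sum_(i < B) \sum_(j < B) (f i * g j + f j * g i).
  rewrite -addnn {2}mulnC !big_distrlr /= -big_split; apply: eq_bigr => i _.
  by rewrite -big_split; apply: eq_bigr => j _ /=; rewrite [g i * _]mulnC.
rewrite -leq_double (D (fun i => n i * b i) (fun i => m i * a i)).
rewrite (D (fun i => n i * a i) (fun i => m i * b i)).
apply: leq_sum => i _; apply: leq_sum => j _ /=.
case: (ltngtP i j) => [ij|ji|->]; last lia.
- have ijB : i < j < B by rewrite ij ltn_ord.
  move: (rearr (nm _ _ ijB) (ab _ _ ijB)); lia.
- have jiB : j < i < B by rewrite ji ltn_ord.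
  move: (rearr (nm _ _ jiB) (ab _ _ jiB)); lia.
Qed.

(** The cross-product form over all i <= j, unlike a_i a_(i+2) <= a_(i+1)^2, also excludes internal
    zeros, so it can be chained without division. *)
Definition log_concave (a : nat -> nat) :=
  forall i j, i <= j -> a i * a j.+1 <= a i.+1 * a j.

Lemma log_concave_spread a x d e : log_concave a ->
  a x * a (x + d + e) <= a (x + d) * a (x + e).
Proof.
move=> ac; elim: d x e => [|d IH] x e; first by rewrite addn0.
case: e => [|e]; first by rewrite !addn0 mulnC.
have := ac x (x + d.+1 + e) ltac:(lia); rewrite -addnS => /leq_trans; apply.
by have := IH x.+1 e; rewrite !addSn !addnS.
Qed.

(** Monotonicity excludes internal zeros: a zero forces all earlier values to vanish, and otherwise
    the induction may cancel [a (i + d)]. *)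
Lemma log_concave_homo a : {homo a : i j / i <= j} ->
  (forall i, a i * a i.+2 <= a i.+1 ^ 2) -> log_concave a.
Proof.
move=> ah ac i j /subnKC <-; elim: (j - i) => [|d IH]; first by rewrite addn0 mulnC.
have [a0|a_gt0] := posnP (a (i + d)).
  by have := ah i (i + d) (leq_addr _ _); rewrite a0 leqn0 => /eqP ->.
rewrite -(leq_pmul2r a_gt0) addnS; have := ac (i + d).
move: IH; move: (a (i + d)) (a (i + d).+1) (a (i + d).+2) a_gt0 => p q r _ H1 H2.
apply: leq_trans (_ : a i * q ^ 2 <= _); first by rewrite -!mulnA leq_mul2l [r * p]mulnC H2 orbT.
have := leq_mul H1 (leqnn q); lia.
Qed.

(* Log-concavity of binomial convolutions is a 2 x 2 minor computation: write
   [binconv] of order n + 1 and n + 2 through the order-n convolution of shifted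
   sequences, and compare the resulting products by [chebyshev_sum]. *)
Definition binconv (n : nat) (a b : nat -> nat) :=
  \sum_(k < n.+1) 'C(n, k) * a k * b (n - k).

Local Notation shift a := (fun k => a k.+1).

Lemma binconvS n a b :
  binconv n.+1 a b = binconv n (shift a) b + binconv n a (shift b).
Proof.
rewrite /binconv big_ord_recl [X in _ = _ + X]big_ord_recl /= !bin0 !subn0.
have E k : 'C(n.+1, bump 0 k) * a (bump 0 k) * b (n.+1 - bump 0 k) =
  'C(n, k) * a k.+1 * b (n - k) + 'C(n, k.+1) * a k.+1 * b (n - k).
  by rewrite [bump 0 k]add1n binS subSS; lia.
under eq_bigr => k _ do rewrite E.
rewrite big_split /= addnCA; congr (_ + (_ + _)).
rewrite big_ord_recr /= bin_small // !mul0n addn0.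
by apply: eq_bigr => k _; rewrite [bump 0 k]add1n; congr (_ * b _); have := ltn_ord k; lia.
Qed.

Lemma binconvC n a b : binconv n a b = binconv n b a.
Proof.
rewrite /binconv (reindex_inj rev_ord_inj); apply: eq_bigr => k _ /=.
have kn : k <= n by rewrite -ltnS.
by rewrite subSS bin_sub // subKn // mulnAC.
Qed.

(** Multiplying by (i + 1)(j + 1) turns the binomial part into (n - j)(i + 1) <= (n - i)(j + 1);
    reversing the index keeps [b] log-concave. *)
Lemma log_concave_binl n b : log_concave b ->
  log_concave (fun k => 'C(n, k) * b (n - k)).
Proof.
move=> bc i j ij; have [nj|jn] := leqP n j; first by rewrite (@bin_small n j.+1) ?ltnS // mul0n muln0.
have bb : 'C(n, i) * 'C(n, j.+1) <= 'C(n, i.+1) * 'C(n, j).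
  rewrite -(@leq_pmul2l (i.+1 * j.+1)) //.
  have := mul_bin_left n i; have := mul_bin_left n j.
  have : (n - j) * i.+1 <= (n - i) * j.+1 by nia.
  move: (n - i) (n - j) ('C(n, i)) ('C(n, j)) ('C(n, i.+1)) ('C(n, j.+1)).
  move=> x y p q r t H Et Er.
  have -> : i.+1 * j.+1 * (p * t) = (y * i.+1) * (p * q) by rewrite -mulnA (mulnCA j.+1) Et; lia.
  have -> : i.+1 * j.+1 * (r * q) = (x * j.+1) * (p * q) by rewrite mulnACA Er; lia.
  by rewrite leq_mul2r H orbT.
have := bc (n - j.+1) (n - i.+1) ltac:(lia).
rewrite !subnSK ?(leq_ltn_trans ij) // => H; have := leq_mul bb H; lia.
Qed.

Lemma binconv_shift2 n a b : log_concave a -> log_concave b ->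
  binconv n a b * binconv n (shift (shift a)) b <= binconv n (shift a) b ^ 2.
Proof.
move=> ac /(@log_concave_binl n) vc; move: vc; set v := fun k => _ => vc.
(* [v'] is [v] delayed by one index, so a shift of the sequence becomes a change of weight over a
   common range; [v] vanishes at the added index n + 1. *)
pose v' k := if k is k'.+1 then v k' else 0.
have vE c : binconv n c b = \sum_(k < n.+2) v k * c k.
  rewrite big_ord_recr /= /v bin_small // !mul0n addn0.
  by apply: eq_bigr => k _; rewrite mulnAC.
have v'E c : binconv n (shift c) b = \sum_(k < n.+2) v' k * c k.
  by rewrite big_ord_recl; apply: eq_bigr => k _; rewrite /= /v mulnAC.
rewrite (vE a) (v'E (shift a)) -mulnn {2}(v'E a) (vE (shift a)).
apply: (@chebyshev_sum _ v v' (shift a) a).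
  move=> [|j] [|i] //=; rewrite ?muln0 // => ji.
  by rewrite mulnC; apply: leq_trans (vc j i _) _ => //; lia.
by move=> j i ji; rewrite mulnC [leqRHS]mulnC; apply: ac; lia.
Qed.

Lemma binconv_shift11 n a b : log_concave a -> log_concave b ->
  binconv n a b * binconv n (shift a) (shift b)
    <= binconv n (shift a) b * binconv n a (shift b).
Proof.
move=> ac bc; rewrite /binconv.
have E (c d : nat -> nat) : \sum_(k < n.+1) 'C(n, k) * c k * d (n - k) =
  \sum_(k < n.+1) ('C(n, k) * d (n - k)) * c k by apply: eq_bigr => k _; rewrite mulnAC.
rewrite (E a b) (E (shift a) b) (E a (shift b)) (E (shift a) (shift b)).
apply: (@chebyshev_sum _ (fun k => 'C(n, k) * b (n - k))
  (fun k => 'C(n, k) * b (n - k).+1) (shift a) a).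
  move=> j i ji; have := bc (n - i) (n - j) ltac:(lia).
  by move=> /(leq_mul (leqnn ('C(n, i) * 'C(n, j)))); lia.
by move=> j i ji; rewrite mulnC [leqRHS]mulnC; apply: ac; lia.
Qed.

Lemma homo_binconv a b : {homo b : i j / i <= j} ->
  {homo (fun n => binconv n a b) : i j / i <= j}.
Proof.
move=> bh; apply: homo_leq leq_trans _ => // n; rewrite [leqRHS]big_ord_recr /=.
apply: leq_trans (leq_addr _ _); apply: leq_sum => k _.
by rewrite !leq_mul ?leq_bin2l //; apply: bh; lia.
Qed.

(** By [binconvS], order n + 1 is P + Q and order n + 2 is R + 2M + U. With c of order n, the minors
    give c R <= P^2, c M <= P Q and c U <= Q^2, which add up to (P + Q)^2. *)
Lemma log_concave_binconv a b : {homo b : i j / i <= j} ->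
  log_concave a -> log_concave b -> log_concave (fun n => binconv n a b).
Proof.
move=> bh ac bc; apply: log_concave_homo; first exact: homo_binconv.
move=> n; rewrite !binconvS.
have := binconv_shift2 n ac bc; have := binconv_shift11 n ac bc.
have := binconv_shift2 n bc ac; rewrite ![binconv n _ a]binconvC.
rewrite -!mulnn; nia.
Qed.

(** The number of surjections from an n-set onto a j-set: the first element picks a colour, which
    the other elements use again or not. *)
Fixpoint surj (n j : nat) : nat :=
  match n, j with
  | 0, 0 => 1
  | n'.+1, j'.+1 => j'.+1 * (surj n' j'.+1 + surj n' j')
  | _, _ => 0
  end.

Lemma log_concave_surj n : log_concave (surj n).
Proof.
elim: n => [|n IH] [|i] [|j] //=; rewrite ?mul0n // ?muln0 // ltnS => ij.
have E1 := IH _ _ (leqW ij) : surj n i * _ <= _.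
have E2 := IH i.+1 j.+1 ij.
(* Both indices move inwards by two; for i = j the factors merely swap. *)
have E3 : surj n i * surj n j.+2 <= surj n i.+2 * surj n j.
  have [->|ltij] := eqVneq i j; first by rewrite mulnC.
  by apply: leq_trans (IH i j.+1 (leqW ij)) _; have := IH i.+1 j ltac:(lia); lia.
have E4 := IH i j ij.
have H : (surj n i.+1 + surj n i) * (surj n j.+2 + surj n j.+1) <=
  (surj n i.+2 + surj n i.+1) * (surj n j.+1 + surj n j) by nia.
have H' : i.+1 * j.+2 <= i.+2 * j.+1 by lia.
by have := leq_mul H' H; lia.
Qed.

(** * A power inequality for even cycles *)

Lemma expnD_tangent_ge x d m : x ^ m.+1 + m.+1 * d * x ^ m <= (x + d) ^ m.+1.
Proof.
elim: m => [|m IH]; first by rewrite !expn1 expn0; lia.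
rewrite [(x + d) ^ _]expnS; apply: leq_trans (leq_mul (leqnn _) IH).
by rewrite !(expnS x); move: (x ^ m) => y; nia.
Qed.

Lemma expnD_tangent_le x d m : (x + d) ^ m.+1 <= x ^ m.+1 + m.+1 * d * (x + d) ^ m.
Proof.
elim: m => [|m IH]; first by rewrite !expn1 expn0; lia.
rewrite [(x + d) ^ m.+2]expnS; apply: leq_trans (leq_mul (leqnn _) IH) _.
have : x ^ m.+1 <= (x + d) ^ m.+1 by rewrite leq_exp2r // leq_addr.
by rewrite (expnS x m.+1) (expnS (x + d) m); move: (x ^ _) ((x + d) ^ m) => y z; nia.
Qed.

(** Here [a] and [a + d] stand for |S| - 1 and |T| - 1. The left factors are the numbers of proper
    colourings of a cycle of length 2(m + 1) from S and from T, and a (a + d) + d = |S| (|T| - 2) +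
    1 is the base in [sum_closed_walks_ge]. *)
Lemma cycle_ineq a d m : 0 < a ->
  (a ^ (2 * m.+1) + a) * ((a + d) ^ (2 * m.+1) + (a + d)) <=
  ((a * (a + d) + d) ^ m.+1 + a) ^ 2.
Proof.
move=> a0; set b := a + d.
have F1 := expnD_tangent_ge (a * b) d m.
have F2 := expnD_tangent_le a d m; rewrite -/b in F2.
have F3 : b ^ m.+1 <= (a * b + d) ^ m.+1 by rewrite leq_exp2r // /b leq_add // ?leq_addr // leq_pmulr // addn_gt0 a0.
have F4 : a ^ m <= b ^ m by case: m {F1 F2 F3} => // m; rewrite leq_exp2r // leq_addr.
have A0 : 0 < a ^ m by rewrite expn_gt0 a0.
have B0 : 0 < b ^ m by rewrite expn_gt0 /b addn_gt0 a0.
have X0 : d <= m.+1 * d by exact: leq_pmull.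
have E (x : nat) : x ^ (2 * m.+1) = (x * x ^ m) ^ 2 by rewrite (mulnC 2) expnM (expnS x m).
rewrite !E; move: F1 F2 F3; rewrite !(expnMn a b).
move: X0; rewrite !(expnS a m) !(expnS b m).
move: (m.+1 * d) (a ^ m) (b ^ m) ((a * b + d) ^ m.+1) A0 B0 F4 => X A' B' U A0 B0 F4 X0 F1 F2 F3.
have [bE ab] : b = a + d /\ a <= b by rewrite /b leq_addr.
move: b bE ab F1 F2 F3 => b bE ab F1 F2 F3.
have AB : a * A' <= b * B' by apply: leq_mul.
(* With A = a^(m+1), B = b^(m+1) = A + D and U = AB + G, the right side minus the left is G (G +
   2AB) - a D^2 - d A^2 + 2aG - ad. The tangent bounds make D small and G large. *)
have [D BE] : exists D, b * B' = a * A' + D by exists (b * B' - a * A'); lia.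
have [G UE] : exists G, U = a * A' * (b * B') + G by exists (U - a * A' * (b * B')); lia.
have D1 : D <= X * B' by lia.
have G1 : X * (A' * B') <= G by lia.
have G2 : d <= G.
  by apply: leq_trans G1; apply: leq_trans X0 _; rewrite leq_pmulr // muln_gt0 A0.
(* [H3], [H2] and [H1] chain to a D^2 + d A^2 <= G (G + 2AB); [H1] amounts to B <= U. *)
have H1 : G * (b * B' + a * A' * (b * B')) <= G * (G + 2 * (a * A' * (b * B'))).
  by rewrite leq_mul2l; apply/orP; right; lia.
have H2 : X * B' * (1 + a) * (b * B') <= G * (b * B' + a * A' * (b * B')).
  have -> : G * (b * B' + a * A' * (b * B')) = G * (1 + a * A') * (b * B') by lia.
  rewrite leq_mul2r; apply/orP; right; apply: leq_trans (leq_mul G1 (leqnn _)).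
  have -> : X * (A' * B') * (1 + a * A') = X * B' * (A' * (1 + a * A')) by lia.
  by rewrite leq_mul2l; apply/orP; right; rewrite mulnDr muln1 mulnCA leq_add // leq_pmulr // muln_gt0 A0.
have H3 : a * D ^ 2 + d * (a * A') ^ 2 <= X * B' * (1 + a) * (b * B').
  apply: leq_trans (_ : a * (X * B') * (b * B') <= _); last first.
    by apply: leq_mul => //; rewrite [leqLHS]mulnC leq_mul2l leqnSn orbT.
  rewrite BE mulnDr addnC leq_add //.
    have -> : d * (a * A') ^ 2 = a * (d * A') * (a * A') by lia.
    by rewrite !leq_mul.
  by rewrite -mulnn -mulnA; rewrite !leq_mul.
rewrite UE; move: H1 H2 H3 G2 BE bE ; move: (a * A') (b * B').
move=> A B H1 H2 H3 G2 BE bE.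
have K : a * D ^ 2 + d * A ^ 2 <= G * (G + 2 * (A * B)).
  exact: leq_trans H3 (leq_trans H2 H1).
have L : a * d <= 2 * (a * G) by apply: leq_trans (leq_pmull _ _); rewrite ?leq_mul2l ?G2 ?orbT.
move: K L; rewrite {}BE {}bE -!mulnn; lia.
Qed.

(** * Reduction to the parts of the blow-up *)

Lemma card_sum_bool (T : finType) (P : pred T) : #|[set x | P x]| = \sum_x P x.
Proof. by rewrite -sum1dep_card big_mkcond; apply: eq_bigr => x _; case: (P x). Qed.

Lemma sum_ffun_pair (V C : finType) (G : {ffun V -> C * C} -> nat) :
  \sum_p G p = \sum_(f : {ffun V -> C}) \sum_(g : {ffun V -> C}) G [ffun v => (f v, g v)].
Proof.
rewrite pair_big /=.
rewrite (reindex (fun fg : {ffun V -> C} * {ffun V -> C} => [ffun v => (fg.1 v, fg.2 v)])) //=.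
exists (fun p => ([ffun v => (p v).1], [ffun v => (p v).2])) => [[f g]|p] _.
  by congr pair; apply/ffunP => v; rewrite !ffunE.
by apply/ffunP => v; rewrite !ffunE -surjective_pairing.
Qed.

Section Patch.
Variables (W V D : finType) (iota : W -> V).
Hypothesis iota_inj : injective iota.

Definition patch (p : {ffun V -> D}) (r : {ffun W -> D}) : {ffun V -> D} :=
  [ffun v => if [pick x | iota x == v] is Some x then r x else p v].

Lemma patch_in p r x : patch p r (iota x) = r x.
Proof.
rewrite ffunE; case: pickP => [y /eqP/iota_inj -> //|/(_ x)]; by rewrite eqxx.
Qed.

Lemma patch_out p r v : (forall x, iota x != v) -> patch p r v = p v.
Proof.
by move=> nv; rewrite ffunE; case: pickP => // x; rewrite (negbTE (nv x)).
Qed.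

(* Exchanging the values on [W] between [p] and [r] is an involution. *)
Lemma sum_patch (G : {ffun V -> D} -> nat) :
  \sum_p \sum_r G (patch p r) = #|{ffun W -> D}| * \sum_p G p.
Proof.
transitivity (\sum_p \sum_(r : {ffun W -> D}) G p); last first.
  by rewrite big_distrr /=; apply: eq_bigr => p _; rewrite sum_nat_const.
rewrite !pair_big /=.
pose swap (pr : {ffun V -> D} * {ffun W -> D}) :=
  (patch pr.1 pr.2, [ffun x => pr.1 (iota x)]).
rewrite [RHS](reindex_inj (_ : injective swap)) //.
apply: (can_inj (g := swap)) => -[p r]; congr pair; apply/ffunP => x; last first.
  by rewrite ffunE /= patch_in.
rewrite ffunE /=; case: pickP => [y /eqP <-|nx]; first by rewrite ffunE.
by apply: patch_out => y; rewrite nx.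
Qed.
End Patch.

Definition proper_in (V : finType) (e : rel V) (C : finType) (S : {set C})
  (f : {ffun V -> C}) :=
  [forall u, f u \in S] && [forall u, forall v, e u v ==> (f u != f v)].

Definition crossed (C : eqType) (x y : C * C) := (x.1 != y.2) && (x.2 != y.1).
Definition straight (C : eqType) (x y : C * C) := (x.1 != y.1) && (x.2 != y.2).

Definition crossed_in (V : finType) (e : rel V) (C : finType) (S T : {set C})
  (p : {ffun V -> C * C}) :=
  [forall u, p u \in setX S T] && [forall u, forall v, e u v ==> crossed (p u) (p v)].

Definition count_col (V : finType) (e : rel V) (C : finType) (S : {set C}) :=
  \sum_f proper_in e S f.

Definition count_crossed (V : finType) (e : rel V) (C : finType) (S T : {set C}) :=
  \sum_p crossed_in e S T p.

(* The list version of the theorem for a single graph, with lists depending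
   only on the copy in the tensor product; it is what makes an induction over
   the vertices of [F] possible. *)
Definition list_tensor_ineq (V : finType) (e : rel V) :=
  forall (C : finType) (S T : {set C}),
    count_col e S * count_col e T <= count_crossed e S T.

Lemma count_col_mul (V : finType) (e : rel V) (C : finType) (S T : {set C}) :
  count_col e S * count_col e T =
  \sum_(p : {ffun V -> C * C}) ([forall u, p u \in setX S T] &&
     [forall u, forall v, e u v ==> straight (p u) (p v)]).
Proof.
rewrite sum_ffun_pair big_distrlr /=; apply: eq_bigr => f _; apply: eq_bigr => g _.
rewrite mulnb; congr nat_of_bool; apply/idP/idP.
  move=> /andP[/andP[/forallP fS /forallP pf] /andP[/forallP gT /forallP pg]].
  apply/andP; split; apply/forallP => u; first by rewrite ffunE inE fS gT.
  apply/forallP => v; apply/implyP => uv; rewrite !ffunE /straight /=.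
  by rewrite (implyP (forallP (pf u) v)) // (implyP (forallP (pg u) v)).
move=> /andP[/forallP fg /forallP pfg].
have fgS u : (f u \in S) && (g u \in T) by have := fg u; rewrite ffunE inE.
have pr u v : e u v -> (f u != f v) && (g u != g v).
  by move=> uv; have := implyP (forallP (pfg u) v) uv; rewrite !ffunE.
by apply/andP; split; apply/andP; split; apply/forallP => u;
  [case/andP: (fgS u) | apply/forallP => v; apply/implyP => /pr /andP[]
  |case/andP: (fgS u) | apply/forallP => v; apply/implyP => /pr /andP[]].
Qed.

Section BlowupStep.
Variables (F : graph) (Hs : gV F -> graph) (C : finType).
Hypothesis F_loopless : forall i, gadj F i i = false.
Let V := {i : gV F & gV (Hs i)}.
Implicit Types (J : {set gV F}) (u v : V) (p : {ffun V -> C * C}).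

Definition same_part_adj u v :=
  (tag u == tag v) && gadj (Hs (tag u)) (tagged u) (tagged_as u v).

(* Parts in [J] carry the crossed constraints, the others the straight ones. *)
Definition hybrid_ok J p u v :=
  (same_part_adj u v ==>
     if tag u \in J then crossed (p u) (p v) else straight (p u) (p v)) &&
  (gadj F (tag u) (tag v) ==> straight (p u) (p v)).

Definition hybrid J p := [forall u, forall v, hybrid_ok J p u v].

Definition free_colours (i : gV F) (c : C * C -> C) p : {set C} :=
  [set a | [forall u, gadj F i (tag u) || gadj F (tag u) i ==> (c (p u) != a)]].

(** Edges of [F] at part [i] are straight whatever [J] is, so they restrict the two coordinates
    separately and leave a product of two lists for [r]. As [F] is loopless, no such edge stays
    inside the part. *)
Lemma hybrid_patch J i p (r : {ffun gV (Hs i) -> C * C}) :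
  hybrid J (patch (fun x => Tagged (fun i => gV (Hs i)) x) p r) =
  [forall u, forall v, (tag u != i) && (tag v != i) ==> hybrid_ok J p u v] &&
  ([forall x, r x \in setX (free_colours i fst p) (free_colours i snd p)] &&
   [forall x, forall y, gadj (Hs i) x y ==>
     if i \in J then crossed (r x) (r y) else straight (r x) (r y)]).
Proof.
pose io (x : gV (Hs i)) : V := Tagged (fun i => gV (Hs i)) x; rewrite -/io; set P := patch _ _ _.
have io_inj : injective io by move=> x y /eqP; rewrite eq_Tagged => /eqP.
have Pin x : P (io x) = r x by exact: patch_in.
have Pout u : tag u != i -> P u = p u.
  by move=> ui; apply: patch_out => x; apply: contraNneq ui => <-.
have vcase u : tag u != i \/ exists x, u = io x.
  by case: u => j x; case: (eqVneq j i) => [ji|]; [right; subst j; exists x|left].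
have spa x y : same_part_adj (io x) (io y) = gadj (Hs i) x y.
  by rewrite /same_part_adj eqxx /= tagged_asE.
apply/idP/idP.
  move=> /forallP H; have {}H u v : hybrid_ok J P u v by exact: (forallP (H u) v).
  apply/and3P; split.
  - apply/forallP => u; apply/forallP => v; apply/implyP => /andP[ui vi].
    by have := H u v; rewrite /hybrid_ok !Pout.
  - apply/forallP => x; rewrite !inE; apply/andP; split; apply/forallP => u; apply/implyP;
      (have [ui|[y ->]] := vcase u; last by rewrite /= F_loopless);
      move=> /orP[iu|iu].
    + by have /andP[_ /implyP/(_ iu)] := H (io x) u; rewrite Pin Pout // /straight eq_sym => /andP[].
    + by have /andP[_ /implyP/(_ iu)] := H u (io x); rewrite Pin Pout // /straight => /andP[].
    + by have /andP[_ /implyP/(_ iu)] := H (io x) u; rewrite Pin Pout // /straight => /andP[_]; rewrite eq_sym.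
    + by have /andP[_ /implyP/(_ iu)] := H u (io x); rewrite Pin Pout // /straight => /andP[].
  - apply/forallP => x; apply/forallP => y; apply/implyP => xy.
    by have /andP[/implyP/=] := H (io x) (io y); rewrite spa !Pin => /(_ xy).
move=> /and3P[/forallP H1 /forallP H2 /forallP H3].
have free x u : gadj F i (tag u) || gadj F (tag u) i ->
    ((p u).1 != (r x).1) && ((p u).2 != (r x).2).
  by have := H2 x; rewrite !inE => /andP[/forallP A /forallP B] iu; rewrite !(implyP (A _)) // (implyP (B _)).
apply/forallP => u; apply/forallP => v.
have [ui|[x ->]] := vcase u; have [vi|[y ->]] := vcase v.
- by have := forallP (H1 u) v; rewrite ui vi /hybrid_ok !Pout.
- rewrite /hybrid_ok /same_part_adj (negbTE ui) /= Pin Pout //; apply/implyP => iu.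
  by rewrite /straight free // iu orbT.
- rewrite /hybrid_ok /same_part_adj [_ == tag v]eq_sym (negbTE vi) /= Pin Pout //; apply/implyP => iv.
  by rewrite /straight ![_ (r x) == _]eq_sym free // iv.
- by rewrite /hybrid_ok spa /= F_loopless andbT !Pin; exact: forallP (H3 x) y.
Qed.

(** Resampling the values on part [i] multiplies both totals by the same positive factor; for fixed
    [p] the sum over [r] is then one instance of [list_tensor_ineq], with the lists that [p] leaves
    free. *)
Lemma hybrid_step J i : i \notin J -> list_tensor_ineq (gadj (Hs i)) -> 0 < #|C| ->
  \sum_p hybrid J p <= \sum_p hybrid (i |: J) p.
Proof.
move=> iJ ineq C0.
have io_inj : injective (fun x : gV (Hs i) => Tagged (fun i => gV (Hs i)) x).
  by move=> x y /eqP; rewrite eq_Tagged => /eqP.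
have K0 : 0 < #|{ffun gV (Hs i) -> C * C}|.
  by rewrite card_ffun expn_gt0 card_prod muln_gt0 C0.
rewrite -(leq_pmul2l K0) -!(sum_patch io_inj); apply: leq_sum => p _.
under eq_bigr => r _ do rewrite hybrid_patch (negbTE iJ) -mulnb.
under [leqRHS]eq_bigr => r _ do rewrite hybrid_patch setU11 -mulnb.
rewrite -!big_distrr /= -count_col_mul leq_mul //.
(* Constraints away from part [i] do not depend on whether [i] lies in [J]. *)
have -> // : [forall u, forall v, (tag u != i) && (tag v != i) ==> hybrid_ok J p u v] =
  [forall u, forall v, (tag u != i) && (tag v != i) ==> hybrid_ok (i |: J) p u v].
apply: eq_forallb => u; apply: eq_forallb => v; rewrite /hybrid_ok !inE.
by case: (tag u == i).
Qed.

Lemma hybrid_le : (forall i, list_tensor_ineq (gadj (Hs i))) -> 0 < #|C| ->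
  \sum_p hybrid set0 p <= \sum_p hybrid setT p.
Proof.
move=> ineq C0.
have H (s : seq (gV F)) : \sum_p hybrid set0 p <= \sum_p hybrid [set x in s] p.
  elim: s => [|i s IH]; first by rewrite set_nil.
  rewrite set_cons; have [si|si] := boolP (i \in [set x in s]).
    by rewrite (setUidPr _) // sub1set.
  exact: leq_trans IH (hybrid_step si (ineq i) C0).
suff -> : setT = [set x in enum (gV F)] by exact: H.
by apply/setP => x; rewrite !inE mem_enum.
Qed.
End BlowupStep.

Lemma blowup_tensor_ineq (F : graph) (Hs : gV F -> graph) (q : nat) :
  bipartite F -> (forall i, list_tensor_ineq (gadj (Hs i))) -> 0 < q ->
  hom (blowup Hs) (K q) ^ 2 <= hom (tensorK2 (blowup Hs)) (K q).
Proof.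
move=> [side sideP] ineq q0.
have loopless i : gadj F i i = false.
  by apply/negP => /sideP; rewrite eqxx.
rewrite /hom -mulnn !card_sum_bool.
have -> : \sum_(f : {ffun gV (blowup Hs) -> gV (K q)})
    [forall u, forall v, gadj (blowup Hs) u v ==> gadj (K q) (f u) (f v)] =
    count_col (gadj (blowup Hs)) [set: 'I_q].
  apply: eq_bigr => f _; rewrite /proper_in.
  suff -> : [forall u, f u \in [set: 'I_q]] by [].
  by apply/forallP => u; rewrite inE.
rewrite count_col_mul.
have := hybrid_le loopless ineq (C := 'I_q); rewrite card_ord => /(_ q0).
set L := (X in X <= _ -> _); set R := (X in _ <= X -> _) => LR.
set A := (X in X <= _); set B := (X in _ <= X).
suff [-> ->] : A = L /\ B = R by [].
split.
  (* With no part crossed, every edge of the blow-up is straight. *)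
  apply: eq_bigr => p _; congr nat_of_bool.
  rewrite (_ : [forall u, _] = true); last by apply/forallP => u; rewrite !inE.
  apply: eq_forallb => u; apply: eq_forallb => v.
  by rewrite /hybrid_ok inE /= /blowup_adj /same_part_adj; case: (_ && _) => //=;
     rewrite ?andbT //; case: (straight _ _); rewrite ?implybT.
pose V := {i : gV F & gV (Hs i)}.
(* The two copies are exchanged on one side of [F]. Edges of [F] change side, so their tensor
   constraints become straight; inside a part the side is constant and they become crossed. *)
pose tw (P : {ffun V * bool -> 'I_q}) : {ffun V -> 'I_q * 'I_q} :=
  [ffun u => (P (u, side (tag u)), P (u, ~~ side (tag u)))].
pose untw (p : {ffun V -> 'I_q * 'I_q}) : {ffun V * bool -> 'I_q} :=
  [ffun ub => if ub.2 == side (tag ub.1) then (p ub.1).1 else (p ub.1).2].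
have twK : cancel tw untw.
  move=> P; apply/ffunP => -[u b]; rewrite !ffunE /=.
  by case: (side _) b => [] [].
have untwK : cancel untw tw.
  by move=> p; apply/ffunP => u; rewrite !ffunE /= eqxx; case: (side _) => /=; case: (p u).
rewrite /R (reindex tw); last by exists untw => ? _.
apply: eq_bigr => P _; congr nat_of_bool; apply/idP/idP.
  move=> /forallP H.
  have {}H u v b : blowup_adj u v -> P (u, b) != P (v, ~~ b).
    move=> uv; apply: (implyP (forallP (H (u, b)) (v, ~~ b))).
    by rewrite /= uv; case: b.
  apply/forallP => u; apply/forallP => v; rewrite /hybrid_ok inE; apply/andP; split; apply/implyP.
    move=> uv; have /eqP tuv : tag u == tag v by case/andP: uv.
    have {}uv : blowup_adj u v by rewrite /blowup_adj; move: uv; rewrite /same_part_adj => ->.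
    rewrite /crossed !ffunE /= -tuv H // -{2}[side (tag u)]negbK H //.
  move=> uv; have sv : side (tag v) = ~~ side (tag u).
    by have := sideP _ _ uv; case: (side _) (side _) => [] [].
  have {}uv : blowup_adj u v by rewrite /blowup_adj uv orbT.
  by rewrite /straight !ffunE /= sv H // H.
move=> /forallP H; have {}H u v : hybrid_ok setT (tw P) u v by exact: (forallP (H u) v).
apply/forallP => -[u b]; apply/forallP => -[v b']; apply/implyP => /= /andP[uv bb'].
have -> : b' = ~~ b by case: b b' bb' => [] [].
have := H u v; rewrite /hybrid_ok inE => /andP[H1 H2]; case/orP: uv => uv.
  have /eqP tuv : tag u == tag v by case/andP: uv.
  have := implyP H1 uv; rewrite /crossed !ffunE /= -tuv => /andP[].
  by have [->//|] := eqVneq b (side (tag u)); case: b {bb'} (side _) => [] [].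
have := implyP H2 uv; rewrite /straight !ffunE /=; have := sideP _ _ uv.
by case: (side _) (side _) b {bb'} => [] [] // [] // _ /andP[].
Qed.

(** * Paths and even cycles *)

Lemma list_tensor_ineq_iso (G G' : graph) :
  isomorphic G G' -> list_tensor_ineq (gadj G') -> list_tensor_ineq (gadj G).
Proof.
move=> [h [[h' hK h'K] adjE]] ineq C S T.
(* An arbitrary list and relation, so that all three counts are transported at once. *)
have re (D : finType) (A : {set D}) (R : rel D) :
    \sum_(p : {ffun gV G -> D}) ([forall u, p u \in A] &&
      [forall u, forall v, gadj G u v ==> R (p u) (p v)]) =
    \sum_(p : {ffun gV G' -> D}) ([forall u, p u \in A] &&
      [forall u, forall v, gadj G' u v ==> R (p u) (p v)]).
  rewrite [RHS](reindex (fun p : {ffun gV G -> D} => [ffun x => p (h' x)])) /=; last first.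
    exists (fun p : {ffun gV G' -> D} => [ffun x => p (h x)]) => p _; apply/ffunP => x; rewrite !ffunE.
      by rewrite hK.
    by rewrite h'K.
  apply: eq_bigr => p _; congr nat_of_bool; congr andb.
    by apply/forallP/forallP => H x; [rewrite ffunE | have := H (h x); rewrite ffunE hK].
  apply/forallP/forallP => H x; apply/forallP => y; apply/implyP => xy.
    by rewrite !ffunE (implyP (forallP (H _) _)) // adjE !h'K.
  by have := implyP (forallP (H (h x)) (h y)); rewrite -adjE !ffunE !hK; exact.
have := ineq C S T; rewrite /count_col /count_crossed.
rewrite -(re _ S (fun x y => x != y)) -(re _ T (fun x y => x != y)).
by rewrite -(re _ (setX S T) (@crossed C)).
Qed.

Section Walks.
Variables (D : finType) (E : rel D).
Implicit Types (A : nat -> {set D}) (n : nat).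

Definition ffun_cons n (c : D) (g : {ffun 'I_n -> D}) : {ffun 'I_n.+1 -> D} :=
  [ffun i => if unlift ord0 i is Some j then g j else c].

Lemma ffun_cons0 n c (g : {ffun 'I_n -> D}) : ffun_cons c g ord0 = c.
Proof. by rewrite ffunE unlift_none. Qed.

Lemma ffun_consS n c (g : {ffun 'I_n -> D}) j : ffun_cons c g (lift ord0 j) = g j.
Proof. by rewrite ffunE liftK. Qed.

Lemma sum_ffun_cons n (G : {ffun 'I_n.+1 -> D} -> nat) :
  \sum_f G f = \sum_c \sum_g G (ffun_cons c g).
Proof.
rewrite pair_big /= (reindex (fun cg : D * {ffun 'I_n -> D} => ffun_cons cg.1 cg.2)) //=.
exists (fun f : {ffun 'I_n.+1 -> D} => (f ord0, [ffun j => f (lift ord0 j)])) => [[c g]|f] _ /=.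
  by rewrite ffun_cons0; congr pair; apply/ffunP => j; rewrite ffunE ffun_consS.
apply/ffunP => i; case: (unliftP ord0 i) => [j|] ->; last by rewrite ffun_cons0.
by rewrite ffun_consS ffunE.
Qed.

Lemma forall_ord_recl n (P : pred 'I_n.+1) :
  [forall i, P i] = P ord0 && [forall j, P (lift ord0 j)].
Proof.
apply/forallP/andP => [H|[H0 /forallP H] i]; first by split=> //; apply/forallP => j.
by case: (unliftP ord0 i) => [j|] ->.
Qed.

Definition chain A n (f : {ffun 'I_n -> D}) :=
  [forall i, f i \in A i] && [forall i : 'I_n, forall j : 'I_n, (i.+1 == j) ==> E (f i) (f j)].

(** An entry of a product of transfer matrices. The starting point is not tested against [A 0];
    [sum_chain] does that. *)
Fixpoint walk A n x y : nat :=
  if n is n'.+1 then \sum_(z in A 1) E x z * walk (shift A) n' z y else (x == y).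

Lemma chain_cons A n c (g : {ffun 'I_n.+1 -> D}) :
  chain A (ffun_cons c g) = [&& c \in A 0, E c (g ord0) & chain (shift A) g].
Proof.
rewrite /chain forall_ord_recl ffun_cons0.
have -> : [forall j, ffun_cons c g (lift ord0 j) \in A (lift ord0 j)] =
   [forall j : 'I_n.+1, g j \in A j.+1].
  by apply: eq_forallb => j; rewrite ffun_consS.
rewrite -!andbA; case: (c \in _) => //=; rewrite [RHS]andbCA; congr andb.
rewrite [X in X = _]forall_ord_recl; congr andb.
  apply/forallP/idP => [/(_ (lift ord0 ord0))|H j]; first by rewrite ffun_cons0 ffun_consS.
  case: (unliftP ord0 j) => [k|] -> //; rewrite ffun_cons0 ffun_consS.
  apply/implyP => /eqP k0; suff -> : k = ord0 by [].
  by apply: val_inj; case: k0.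
apply: eq_forallb => i; rewrite forall_ord_recl /=; apply: eq_forallb => j.
by rewrite !ffun_consS.
Qed.

(** The end weight [G] serves twice: in the induction it absorbs the first edge, and later it
    carries the edge closing a cycle. *)
Lemma sum_chain A n (G : D -> D -> nat) :
  \sum_(f : {ffun 'I_n.+1 -> D}) chain A f * G (f ord0) (f ord_max) =
  \sum_(x in A 0) \sum_y walk A n x y * G x y.
Proof.
elim: n A G => [|n IH] A G; rewrite sum_ffun_cons [RHS]big_mkcond; apply: eq_bigr => c _.
  have -> : ord_max = ord0 :> 'I_1 by exact: val_inj.
  under eq_bigr => g _ do rewrite ffun_cons0.
  have -> : \sum_y walk A 0 c y * G c y = G c c.
    rewrite (bigD1 c) //= eqxx mul1n big1 ?addn0 // => y.
    by rewrite eq_sym => /negbTE ->.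
  rewrite -big_distrl /= (eq_bigr (fun=> (c \in A 0) : nat)) => [|g _].
    by rewrite sum_nat_const card_ffun card_ord expn0 mul1n; case: (c \in A 0); rewrite ?mul1n.
  rewrite /chain !forall_ord_recl ffun_cons0 /=.
  by rewrite !(introT forallP _) ?andbT // => -[].
have -> : ord_max = lift ord0 ord_max :> 'I_n.+2 by exact: val_inj.
under eq_bigr => g _ do rewrite chain_cons ffun_cons0 ffun_consS.
case: (c \in A 0) => /=; last by rewrite big1.
under eq_bigr => g _ do rewrite -mulnb [_ * chain _ _]mulnC -mulnA.
rewrite (IH (shift A) (fun z y => E c z * G c y)).
under [RHS]eq_bigr => y _ do rewrite big_distrl /=.
rewrite [RHS]exchange_big /=; apply: eq_bigr => z _; apply: eq_bigr => y _.
by rewrite mulnA [walk _ _ _ _ * _]mulnC.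
Qed.

Lemma eq_walk A B n x y : (forall i, A i = B i) -> walk A n x y = walk B n x y.
Proof.
elim: n A B x => [|n IH] A B x AB //=; rewrite AB; apply: eq_bigr => z _.
by rewrite (IH _ (shift B)).
Qed.

(** [walk] unfolds at its first step; closing a cycle needs the last one. *)
Lemma walkSr A n x y : y \in A n.+1 ->
  walk A n.+1 x y = \sum_z walk A n x z * E z y.
Proof.
elim: n A x => [|n IH] A x yA.
  rewrite /= (bigD1 y) //= eqxx muln1 big1 => [|z /andP[_ /negbTE ->]]; last by rewrite muln0.
  rewrite (bigD1 x) //= eqxx mul1n big1 // => z; by rewrite eq_sym => /negbTE ->.
transitivity (\sum_(z in A 1) E x z * walk (shift A) n.+1 z y) => //.
under [RHS]eq_bigr => z _ do rewrite /= big_distrl /=.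
rewrite [RHS]exchange_big; apply: eq_bigr => z _; rewrite IH // big_distrr /=.
by apply: eq_bigr => w _; rewrite mulnA.
Qed.

Lemma chain_count_ge (A : {set D}) n k :
  (forall x, x \in A -> k <= #|[set z in A | E x z]|) ->
  #|A| * k ^ n <= \sum_(f : {ffun 'I_n.+1 -> D}) chain (fun=> A) f.
Proof.
move=> H; under eq_bigr => f _ do rewrite -[nat_of_bool _]muln1.
rewrite (sum_chain _ _ (fun _ _ => 1)) -sum_nat_const; apply: leq_sum => x xA.
under eq_bigr => y _ do rewrite muln1.
elim: n x xA => [|n IH] x xA; first by rewrite expn0 /= (bigD1 x) //= eqxx.
rewrite exchange_big /= expnS (leq_trans (leq_mul (H x xA) (leqnn _))) //.
rewrite -sum_nat_const [leqRHS](bigID (E x)) /= (leq_trans _ (leq_addr _ _)) //.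
under eq_bigl => z do rewrite inE.
apply: leq_sum => z /andP[zA ->]; under eq_bigr => y _ do rewrite mul1n.
exact: IH.
Qed.

Lemma chain_count_le (A : {set D}) n k :
  (forall x, x \in A -> #|[set z in A | E x z]| <= k) ->
  \sum_(f : {ffun 'I_n.+1 -> D}) chain (fun=> A) f <= #|A| * k ^ n.
Proof.
move=> H; under eq_bigr => f _ do rewrite -[nat_of_bool _]muln1.
rewrite (sum_chain _ _ (fun _ _ => 1)) -sum_nat_const; apply: leq_sum => x xA.
under eq_bigr => y _ do rewrite muln1.
elim: n x xA => [|n IH] x xA.
  rewrite expn0 /= (bigD1 x) //= eqxx big1 // => y; by rewrite eq_sym => /negbTE ->.
rewrite exchange_big /= expnS (leq_trans _ (leq_mul (H x xA) (leqnn _))) //.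
rewrite -sum_nat_const [leqLHS](bigID (E x)) /= addnC big1 ?add0n => [|z /andP[_ /negbTE ->]]; last first.
  by rewrite big1.
under [leqRHS]eq_bigl => z do rewrite inE.
apply: leq_sum => z /andP[zA ->]; under eq_bigr => y _ do rewrite mul1n.
exact: IH.
Qed.
End Walks.

Lemma path_chain n (D : finType) (R : rel D) (A : {set D}) (f : {ffun 'I_n -> D}) :
  symmetric R ->
  [forall u, f u \in A] &&
    [forall u, forall v, gadj (path_graph n) u v ==> R (f u) (f v)] =
  chain R (fun=> A) f.
Proof.
move=> Rs; rewrite /chain; congr andb; apply/forallP/forallP => H u; apply/forallP => v; apply/implyP.
  by move=> uv; apply: (implyP (forallP (H u) v)); rewrite /= uv.
by case/orP => uv; [|rewrite Rs]; apply: (implyP (forallP (H _) _)).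
Qed.

Lemma neq_sym (C : eqType) : symmetric (fun x y : C => x != y).
Proof. by move=> x y; rewrite eq_sym. Qed.

Lemma crossed_sym (C : eqType) : symmetric (@crossed C).
Proof. by move=> x y; rewrite /crossed andbC ![_ == y.1]eq_sym ![_ == y.2]eq_sym. Qed.

(** The colourings number at most |S| (|S| - 1)^n and |T| (|T| - 1)^n, while every crossed pair has
    at least (|S| - 1)(|T| - 1) continuations. *)
Lemma path_list_tensor_ineq n : 0 < n -> list_tensor_ineq (gadj (path_graph n)).
Proof.
case: n => // n _ C S T.
have col (A : {set C}) : count_col (gadj (path_graph n.+1)) A <= #|A| * #|A|.-1 ^ n.
  rewrite (_ : count_col _ _ = \sum_(f : {ffun 'I_n.+1 -> C}) chain (fun x y => x != y) (fun=> A) f); last first.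
    by apply: eq_bigr => f _; congr nat_of_bool; exact: path_chain (@neq_sym C).
  apply: chain_count_le => x xA; rewrite (cardsD1 x A) xA /=.
  by apply/subset_leq_card/subsetP => z; rewrite !inE eq_sym andbC.
apply: leq_trans (leq_mul (col S) (col T)) _; rewrite mulnACA -expnMn -cardsX.
rewrite /count_crossed.
under eq_bigr => p _ do rewrite /crossed_in (path_chain _ _ (@crossed_sym C)).
apply: chain_count_ge => -[a b]; rewrite inE /= => /andP[aS bT].
(* After (a, b), the next pair avoids b in its first coordinate and a in its second. *)
apply: leq_trans (_ : #|setX (S :\ b) (T :\ a)| <= _).
  rewrite cardsX leq_mul //.
    by rewrite (cardsD1 b S); case: (b \in S); lia.
  by rewrite (cardsD1 a T); case: (a \in T); lia.
apply/subset_leq_card/subsetP => -[c d]; rewrite !inE /crossed /=.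
by rewrite ![_ == a]eq_sym ![_ == b]eq_sym => /andP[/andP[-> ->] /andP[-> ->]].
Qed.

(** * Even cycles as closed walks with alternating lists *)

Section AlternatingCycle.
Variables (C : finType) (N : nat).
Implicit Types S T : {set C}.

Definition alt S T i := if odd i then T else S.

Definition alt_cycle S T (f : {ffun 'I_N -> C}) :=
  [forall i : 'I_N, f i \in alt S T i] && [forall i, f i != f (ordS i)].

Lemma cycle_forall_adj (D : finType) (R : rel D) (f : {ffun 'I_N -> D}) :
  symmetric R ->
  [forall u, forall v, gadj (cycle_graph N) u v ==> R (f u) (f v)] =
  [forall i, R (f i) (f (ordS i))].
Proof.
move=> Rs; apply/forallP/forallP => H u.
  by apply: (implyP (forallP (H u) (ordS u))); rewrite /= eqxx.
have R' (i j : 'I_N) : i.+1 %% N == j -> R (f i) (f j).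
  by move=> /eqP ij; rewrite (_ : j = ordS i) ?H //; apply: val_inj.
by apply/forallP => v; apply/implyP => /orP[|/R']; [exact: R' | rewrite Rs].
Qed.

Lemma forall_ordS (P : pred 'I_N) : [forall i, P (ordS i)] = [forall i, P i].
Proof.
apply/forallP/forallP => H i; last exact: H.
by have [g _ gK] := ordS_bij N; rewrite -(gK i).
Qed.

Hypothesis N_even : ~~ odd N.

Lemma odd_ordS (i : 'I_N) : odd (ordS i) = ~~ odd i.
Proof.
have [lt|] := ltnP i.+1 N; first by rewrite /= modn_small.
(* Wrap-around: i + 1 = N is even, so i is odd and its successor is 0. *)
rewrite leq_eqVlt ltnNge ltn_ord orbF => /eqP E; rewrite [LHS]/=.
have := N_even; rewrite [X in odd X]E /= negbK => ->.
by rewrite -[i.+1]E modnn.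
Qed.

(** Rotation by one vertex exchanges the two lists; this makes the crossed count of
    [count_crossed_cycle] a square. *)
Lemma alt_cycle_rot S T : \sum_f alt_cycle S T f = \sum_f alt_cycle T S f.
Proof.
have [g gK Kg] := ordS_bij N.
rewrite (reindex (fun f : {ffun 'I_N -> C} => [ffun i => f (ordS i)])) /=; last first.
  exists (fun f : {ffun 'I_N -> C} => [ffun i => f (g i)]) => f _; apply/ffunP => i.
    by rewrite !ffunE Kg.
  by rewrite !ffunE gK.
apply: eq_bigr => f _; congr nat_of_bool; congr andb.
  rewrite -[RHS](forall_ordS (fun i => f i \in alt T S i)); apply: eq_forallb => i.
  by rewrite ffunE /alt odd_ordS; case: odd.
rewrite -[RHS](forall_ordS (fun i => f i != f (ordS i))); apply: eq_forallb => i.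
by rewrite !ffunE.
Qed.

(* On an even cycle a crossed pair of colourings becomes a pair of proper ones
   after exchanging the two colours at every odd vertex. *)
Lemma count_crossed_cycle S T :
  count_crossed (gadj (cycle_graph N)) S T =
  (\sum_f alt_cycle S T f) * (\sum_f alt_cycle T S f).
Proof.
pose tw (p : {ffun 'I_N -> C * C}) : {ffun 'I_N -> C * C} :=
  [ffun i : 'I_N => if odd i then ((p i).2, (p i).1) else p i].
have twK : involutive tw.
  by move=> p; apply/ffunP => i; rewrite !ffunE; case: odd => //; case: (p i).
rewrite /count_crossed (reindex_inj (inv_inj twK)) sum_ffun_pair big_distrlr /=.
apply: eq_bigr => f _; apply: eq_bigr => g _; rewrite mulnb; congr nat_of_bool.
rewrite /crossed_in (cycle_forall_adj _ (@crossed_sym C)) /alt_cycle.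
have E1 i : (tw [ffun v => (f v, g v)] i \in setX S T) =
    (f i \in alt S T i) && (g i \in alt T S i).
  by rewrite !ffunE inE /alt; case: odd => //=; rewrite andbC.
have E2 i : crossed (tw [ffun v => (f v, g v)] i) (tw [ffun v => (f v, g v)] (ordS i)) =
    (f i != f (ordS i)) && (g i != g (ordS i)).
  by rewrite !ffunE odd_ordS /crossed; case: odd => //=; rewrite andbC.
rewrite (eq_forallb E1) (eq_forallb E2).
apply/andP/andP => [[/forallP H1 /forallP H2]|[/andP[/forallP H1 /forallP H2] /andP[/forallP H3 /forallP H4]]].
  by split; apply/andP; split; apply/forallP => i;
    [case/andP: (H1 i)|case/andP: (H2 i)|case/andP: (H1 i)|case/andP: (H2 i)].
by split; apply/forallP => i; rewrite ?H1 ?H2 ?H3 ?H4.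
Qed.

Lemma count_col_cycle S : count_col (gadj (cycle_graph N)) S = \sum_f alt_cycle S S f.
Proof.
apply: eq_bigr => f _; congr nat_of_bool.
rewrite /proper_in (cycle_forall_adj _ (@neq_sym C)); congr andb.
by apply: eq_forallb => i; rewrite /alt if_same.
Qed.
End AlternatingCycle.

Lemma alt_cycle_walk (C : finType) n (S T : {set C}) : ~~ odd n.+1 ->
  \sum_(f : {ffun 'I_n.+1 -> C}) alt_cycle S T f =
  \sum_(x in S) walk (fun x y => x != y) (alt S T) n.+1 x x.
Proof.
move=> en.
transitivity (\sum_(f : {ffun 'I_n.+1 -> C})
    chain (fun x y => x != y) (alt S T) f * (f ord_max != f ord0)).
  apply: eq_bigr => f _; rewrite mulnb; congr nat_of_bool.
  rewrite /alt_cycle /chain -andbA; congr andb.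
  have S0 : ordS (ord_max : 'I_n.+1) = ord0 by apply: val_inj; rewrite /= modnn.
  apply/forallP/andP => [H|[/forallP H1 H2] i].
    split; last by have := H ord_max; rewrite S0.
    apply/forallP => i; apply/forallP => j; apply/implyP => /eqP ij.
    have -> : j = ordS i by apply: val_inj; rewrite /= ij modn_small.
    exact: H.
  have [->|ni] := eqVneq i ord_max; first by rewrite S0.
  apply: (implyP (forallP (H1 i) _)); apply/eqP; rewrite /= modn_small // ltn_neqAle ltn_ord andbT.
  by apply: contra ni => /eqP [E]; apply/eqP/val_inj.
rewrite (sum_chain _ _ _ (fun x y => (y != x) : nat)); apply: eq_bigr => x xS.
(* The closing edge becomes a last step to x at index n + 1, which is even, so the list there is
   S. *)
by rewrite walkSr // /alt (negbTE en).
Qed.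

Section TwoStep.
Variables (C : finType) (S T : {set C}).
Local Notation W := (walk (fun x y : C => x != y) (alt S T)).

(** Grouping steps in pairs through a colour of T leaves a matrix indexed by S alone, with entries
    |T minus {x, w}|. *)
Lemma walkSS n x y :
  W n.+2 x y = \sum_(w in S) #|[set z in T | (x != z) && (z != w)]| * W n w y.
Proof.
rewrite /=; under eq_bigr => z _ do rewrite big_distrr /=.
rewrite exchange_big /=; apply: eq_bigr => w _.
rewrite -sum1dep_card big_mkcondr big_distrl /= [LHS]big_mkcond [RHS]big_mkcond /=.
apply: eq_bigr => z _; rewrite /alt /=; case: (z \in T) => //.
rewrite (@eq_walk C _ (shift (shift (alt S T))) (alt S T)) => [|i]; last by rewrite /alt /= negbK.
by rewrite mulnA mulnb; case: andb.
Qed.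

(* The powers of [k J + I] are [iter m (two_step s k) 0 J + I]. *)
Definition two_step (s k al : nat) := k * (s * al + 1) + al.

(** Both sides are the row sum of the m-th power of k J + I, of size s. *)
Lemma two_step_iter s k m : s * iter m (two_step s k) 0 + 1 = (s * k + 1) ^ m.
Proof.
elim: m => [|m IH] /=; first by rewrite muln0.
by rewrite expnS -IH /two_step; lia.
Qed.

(** The (x, y) entry of the product (k J + I)(al J + I) indexed by S. *)
Lemma sum_two_step k al x y : x \in S -> y \in S ->
  \sum_(w in S) (k + (x == w)) * (al + (w == y)) = two_step #|S| k al + (x == y).
Proof.
move=> xS yS.
have sumd z : z \in S -> \sum_(w in S) (w == z) = 1.
  by move=> zS; rewrite (bigD1 z) //= eqxx big1 // => w /andP[_ /negbTE ->].
under eq_bigr => w _ do rewrite mulnDl.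
rewrite big_split /= -big_distrr big_split /= sum_nat_const sumd //.
rewrite (bigD1 x) //= eqxx big1 => [|w /andP[_]]; last by rewrite eq_sym => /negbTE ->.
by rewrite /two_step; lia.
Qed.

Lemma walk_two_step_ge k m x y :
  (forall x w, x \in S -> w \in S -> k + (x == w) <= #|[set z in T | (x != z) && (z != w)]|) ->
  x \in S -> y \in S -> iter m (two_step #|S| k) 0 + (x == y) <= W m.*2 x y.
Proof.
move=> H; elim: m x => [|m IH] x xS yS //.
rewrite doubleS walkSS iterS -sum_two_step //; apply: leq_sum => w wS.
by rewrite leq_mul ?H ?IH.
Qed.

Lemma walk_two_step_le k m x y :
  (forall x w, x \in S -> w \in S -> #|[set z in T | (x != z) && (z != w)]| <= k + (x == w)) ->
  x \in S -> y \in S -> W m.*2 x y <= iter m (two_step #|S| k) 0 + (x == y).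
Proof.
move=> H; elim: m x => [|m IH] x xS yS //.
rewrite doubleS walkSS iterS -sum_two_step //; apply: leq_sum => w wS.
by rewrite leq_mul ?H ?IH.
Qed.
End TwoStep.

Lemma card_avoid2 (C : finType) (T : {set C}) x w :
  [set z in T | (x != z) && (z != w)] = T :\ x :\ w.
Proof. by apply/setP => z; rewrite !inE [x == z]eq_sym andbC -andbA andbCA. Qed.

(** Removing x and w costs T at most two colours, and at most one when x = w, so the two-step matrix
    dominates k J + I with k = |T| - 2; the bound is the trace of its m-th power. *)
Lemma sum_closed_walks_ge (C : finType) (S T : {set C}) m : 1 < #|T| ->
  (#|S| * (#|T| - 2) + 1) ^ m + #|S| - 1 <=
  \sum_(x in S) walk (fun x y : C => x != y) (alt S T) m.*2 x x.
Proof.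
move=> T1; rewrite -two_step_iter.
apply: leq_trans (_ : \sum_(x in S) (iter m (two_step #|S| (#|T| - 2)) 0 + 1) <= _).
  by rewrite sum_nat_const; lia.
apply: leq_sum => x xS.
have := @walk_two_step_ge _ S T (#|T| - 2) m x x; rewrite eqxx; apply=> // {xS}x w _ _.
rewrite card_avoid2; have [->|xw] := eqVneq x w.
  by rewrite setDDl setUid; have := cardsD1 w T; case: (w \in T) => /=; lia.
by have := cardsD1 x T; have := cardsD1 w (T :\ x); do 2 case: (_ \in _) => /=; lia.
Qed.

(** With equal lists, x and w really lie in S, so the colours lost are counted exactly. *)
Lemma sum_closed_walks_le (C : finType) (S : {set C}) m : 1 < #|S| ->
  \sum_(x in S) walk (fun x y : C => x != y) (alt S S) m.*2 x x <=
  (#|S| * (#|S| - 2) + 1) ^ m + #|S| - 1.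
Proof.
move=> S1; rewrite -two_step_iter.
apply: leq_trans (_ : \sum_(x in S) (iter m (two_step #|S| (#|S| - 2)) 0 + 1) <= _); last first.
  by rewrite sum_nat_const; lia.
apply: leq_sum => x xS.
have := @walk_two_step_le _ S S (#|S| - 2) m x x; rewrite eqxx; apply=> // {xS}x w xS wS.
rewrite card_avoid2; have [->|xw] := eqVneq x w.
  by rewrite setDDl setUid; have := cardsD1 w S; rewrite wS /=; lia.
have := cardsD1 x S; have := cardsD1 w (S :\ x).
by rewrite !inE eq_sym xw xS wS /=; lia.
Qed.

Lemma cycle_list_tensor_ineq m : list_tensor_ineq (gadj (cycle_graph (2 * m.+1))).
Proof.
move=> C S T.
have En : 2 * m.+1 = m.*2.+2 by lia.
have ev : ~~ odd (2 * m.+1) by rewrite oddM.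
rewrite count_crossed_cycle // !count_col_cycle.
have cw (A B : {set C}) : \sum_(f : {ffun 'I_(2 * m.+1) -> C}) alt_cycle A B f =
    \sum_(x in A) walk (fun x y : C => x != y) (alt A B) m.+1.*2 x x.
  by move: ev; rewrite En => ev; rewrite alt_cycle_walk.
wlog st : S T / #|S| <= #|T|.
  move=> H; have [|/ltnW] := leqP #|S| #|T|; first exact: H.
  by move=> /H; rewrite mulnC [leqRHS]mulnC.
(* One colour cannot serve two adjacent vertices. Once this case is gone, the subtractions |S| - 2
   and |T| - 2 are exact. *)
have small (A : {set C}) : #|A| <= 1 -> \sum_(f : {ffun 'I_(2 * m.+1) -> C}) alt_cycle A A f = 0.
  move=> /card_le1P A1; rewrite big1 // => f _; apply/eqP; rewrite eqb0 negb_and.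
  move: f; rewrite En => f.
  apply/orP; case: (boolP [forall i, f i \in alt A A i]) => [/forallP fA|]; [right|by left].
  have fA' i : f i \in A by have := fA i; rewrite /alt if_same.
  apply/forallPn; exists ord0; rewrite negbK eq_sym.
  by have := A1 _ (fA' ord0) (f (ordS ord0)); rewrite fA' inE => /esym.
have [/small -> //|S1] := leqP #|S| 1.
have T1 := leq_trans S1 st.
(* Both factors now count closed walks starting in the smaller list S. *)
rewrite -(alt_cycle_rot ev S T) !cw.
apply: leq_trans (leq_mul (sum_closed_walks_le _ S1) (sum_closed_walks_le _ T1)) _.
have LB := sum_closed_walks_ge S m.+1 T1; apply: leq_trans (leq_mul LB LB).
have [a aE] : exists a, #|S| = a.+1 by exists #|S|.-1; lia.
have [d dE] : exists d, #|T| = (a + d).+1 by exists (#|T| - #|S|); lia.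
have a0 : 0 < a by lia.
have := cycle_ineq d m a0; rewrite aE dE -mulnn !expnM.
have -> : a ^ 2 = a.+1 * (a.+1 - 2) + 1 by nia.
have -> : (a + d) ^ 2 = (a + d).+1 * ((a + d).+1 - 2) + 1 by nia.
have -> : a * (a + d) + d = a.+1 * ((a + d).+1 - 2) + 1 by nia.
by rewrite !addnS !subn1.
Qed.

(** * Complete multipartite graphs *)

(** Maps are grouped by their image X, which is hit by [surj n #|X|] of them. *)
Lemma sum_ffun_image_ord (C : finType) n (G : {set C} -> nat) :
  \sum_(f : {ffun 'I_n -> C}) G [set f x | x : 'I_n] = \sum_(X : {set C}) surj n #|X| * G X.
Proof.
elim: n G => [|n IH] G.
  rewrite (eq_bigr (fun=> G set0)) => [|f _]; last first.
    by congr G; apply/setP => y; rewrite inE; apply/imsetP => -[[]].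
  rewrite sum_nat_const card_ffun card_ord expn0 mul1n (bigD1 set0) //= cards0 mul1n.
  by rewrite big1 ?addn0 // => X; rewrite -card_gt0; case: #|X|.
rewrite sum_ffun_cons.
have im c (g : {ffun 'I_n -> C}) : [set ffun_cons c g x | x : 'I_n.+1] = c |: [set g x | x : 'I_n].
  apply/setP => y; rewrite !inE; apply/imsetP/orP => [[x _ ->]|[/eqP ->|/imsetP [x _ ->]]].
  - case: (unliftP ord0 x) => [j|] ->; first by rewrite ffun_consS imset_f ?orbT //; right.
    by rewrite ffun_cons0; left.
  - by exists ord0; rewrite ?ffun_cons0.
  - by exists (lift ord0 x); rewrite ?ffun_consS.
under eq_bigr => c _ do [under eq_bigr => g _ do rewrite im].
under eq_bigr => c _ do rewrite (IH (fun X => G (c |: X))).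
(* If X is the full image and c the first value, the remaining values have image X or X minus c.
   Summing over c in X then gives the factor |X| of the recursion. *)
transitivity (\sum_c \sum_(X : {set C} | c \in X) (surj n #|X| + surj n #|X|.-1) * G X).
  apply: eq_bigr => c _; rewrite (bigID (fun X : {set C} => c \in X)) /=.
  under [RHS]eq_bigr => X _ do rewrite mulnDl.
  rewrite [RHS]big_split /=; congr (_ + _).
    by apply: eq_bigr => X cX; rewrite (setUidPr _) // sub1set.
  rewrite (reindex_onto (fun X : {set C} => X :\ c) (fun X => c |: X)) /=; last first.
    by move=> X cX; rewrite setU1K.
  apply: eq_big => X; first by rewrite !inE eqxx /=; apply/eqP/idP => [XE|]; [rewrite -XE setU11|exact: setD1K].
  move=> /andP[_ /eqP XE]; have cX : c \in X by rewrite -XE setU11.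
  by rewrite XE (cardsD1 c X) cX.
rewrite (exchange_big_dep xpredT) //=; apply: eq_bigr => X _.
by rewrite sum_nat_const; case: #|X| => [|j] //=; rewrite mulnA.
Qed.

Lemma sum_ffun_image (W C : finType) (G : {set C} -> nat) :
  \sum_(f : {ffun W -> C}) G [set f x | x : W] = \sum_(X : {set C}) surj #|W| #|X| * G X.
Proof.
rewrite -sum_ffun_image_ord.
rewrite (reindex (fun f : {ffun 'I_#|W| -> C} => [ffun x => f (enum_rank x)])) /=; last first.
  exists (fun f : {ffun W -> C} => [ffun i => f (enum_val i)]) => f _; apply/ffunP => i;
    by rewrite !ffunE ?enum_valK ?enum_rankK.
apply: eq_bigr => f _; congr G; apply/setP => y; apply/imsetP/imsetP => -[x _ ->].
  by rewrite ffunE; exists (enum_rank x).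
by exists (enum_val x); rewrite ?ffunE ?enum_valK.
Qed.

(** The range B is free so that sums over subsets of different sets share one range, as
    [chebyshev_sum] requires. *)
Lemma sum_subset_card (C : finType) (S : {set C}) B (g : nat -> nat) : #|S| < B ->
  \sum_(X : {set C} | X \subset S) g #|X| = \sum_(j < B) 'C(#|S|, j) * g j.
Proof.
case: B => // B SB.
rewrite (partition_big (fun X : {set C} => inord #|X| : 'I_B.+1) xpredT) //=.
apply: eq_bigr => j _; rewrite -cards_draws -sum1dep_card big_distrl /=.
have le (X : {set C}) : X \subset S -> #|X| < B.+1 by move=> /subset_leq_card XS; exact: leq_ltn_trans XS SB.
apply: eq_big => [X|X /andP[XS /eqP <-]]; last by rewrite mul1n inordK ?le.
case XS: (X \subset S) => //=; rewrite -(inj_eq val_inj) /= inordK ?le //.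
Qed.

Lemma sum_subset_split (C : finType) (S T : {set C}) (G : {set C} -> nat) :
  \sum_(Y : {set C} | Y \subset T) G Y =
  \sum_(Z : {set C} | Z \subset T :\: S) \sum_(Y : {set C} | Y \subset S :&: T) G (Y :|: Z).
Proof.
rewrite (partition_big (fun Y : {set C} => Y :\: S) (fun Z => Z \subset T :\: S)) /=; last first.
  by move=> Y YT; exact: setSD.
apply: eq_bigr => Z; rewrite subsetD => /andP[ZT ZS].
rewrite (reindex_onto (fun Y : {set C} => Y :|: Z) (fun Y => Y :&: S)) /=.
  apply: eq_bigl => Y; rewrite subUset ZT andbT setDUl setIUl (setDidPl ZS).
  have -> : Z :&: S = set0 by apply: disjoint_setI0.
  rewrite setU0 subsetI; apply/idP/idP.
    by move=> /andP[/andP[-> _] /eqP/setIidPl ->].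
  move=> /andP[YS YT]; have /eqP D0 : Y :\: S == set0 by rewrite setD_eq0.
  by rewrite YT (setIidPl YS) D0 set0U !eqxx.
by move=> Y /andP[_ /eqP <-]; rewrite setID.
Qed.

(** The ratio C(r, k) / C(s, k) decreases with k: one step multiplies it by (r - k) / (s - k). *)
Lemma bin_ratio r s i j : r <= s -> j <= i -> 'C(r, i) * 'C(s, j) <= 'C(r, j) * 'C(s, i).
Proof.
move=> rs /subnKC <-; elim: (i - j) => [|d IH]; first by rewrite addn0.
rewrite addnS -(leq_pmul2l (ltn0Sn (j + d))) mulnA mul_bin_left [leqRHS]mulnCA mul_bin_left.
have : r - (j + d) <= s - (j + d) by lia.
by move=> /leq_mul /(_ IH); rewrite !mulnA [_ * 'C(r, j)]mulnC.
Qed.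

(* Colourings of a join of an edgeless part with a graph having [pi k]
   colourings from [k] colours: giving the two sides different lists helps. *)
Lemma join_lists_ineq (C : finType) (S T : {set C}) (sg pi : nat -> nat) :
  log_concave sg -> log_concave pi -> {homo pi : i j / i <= j} ->
  (\sum_(X : {set C} | X \subset S) sg #|X| * pi #|S :\: X|) *
    (\sum_(Y : {set C} | Y \subset T) sg #|Y| * pi #|T :\: Y|) <=
  (\sum_(X : {set C} | X \subset S) sg #|X| * pi #|T :\: X|) *
    (\sum_(Y : {set C} | Y \subset T) sg #|Y| * pi #|S :\: Y|).
Proof.
move=> sgc pic pih; wlog st : S T / #|S| <= #|T|.
  move=> H; have [|/ltnW] := leqP #|S| #|T|; first exact: H.
  by move=> /H; rewrite mulnC [leqRHS]mulnC.
(* The colours Z of Y outside S are fixed; the inequality is proved for each Z. *)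
rewrite !(sum_subset_split S T) !big_distrr /=; apply: leq_sum => Z; rewrite subsetD => /andP[ZT ZS].
set s := #|S|; set t := #|T|; set l := #|Z|; pose r := #|S :&: T|.
have rs : r <= s by exact: subset_leq_card (subsetIl S T).
have dis (Y : {set C}) : Y \subset S :&: T -> #|Y :|: Z| = #|Y| + l.
  rewrite subsetI => /andP[YS _]; rewrite cardsU (_ : Y :&: Z = set0) ?cards0 ?subn0 //.
  by apply: disjoint_setI0; rewrite disjoint_sym; apply: disjointWr ZS.
have E1 : \sum_(X : {set C} | X \subset S) sg #|X| * pi #|S :\: X| =
    \sum_(i < s.+1) 'C(s, i) * sg i * pi (s - i).
  rewrite (eq_bigr (fun X : {set C} => sg #|X| * pi (s - #|X|))) => [|X XS].
    rewrite (sum_subset_card (fun i => sg i * pi (s - i)) (ltnSn s)).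
    by apply: eq_bigr => i _; rewrite mulnA.
  by rewrite cardsDS.
have E2 : \sum_(i < s.+1) 'C(s, i) * sg i * pi (t - i) <=
    \sum_(X : {set C} | X \subset S) sg #|X| * pi #|T :\: X|.
  rewrite (eq_bigr (fun i : 'I_s.+1 => 'C(s, i) * (sg i * pi (t - i)))) => [|i _]; last by rewrite mulnA.
  rewrite -(sum_subset_card (fun i => sg i * pi (t - i)) (ltnSn s)); apply: leq_sum => X _.
  by rewrite leq_mul // pih // cardsD leq_sub2l // subset_leq_card ?subsetIr.
(* The true argument of [pi] is t - i - l; raising it to t - i matches [E2]. *)
have E3 : \sum_(Y : {set C} | Y \subset S :&: T) sg #|Y :|: Z| * pi #|T :\: (Y :|: Z)| <=
    \sum_(i < s.+1) 'C(r, i) * sg (i + l) * pi (t - i).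
  rewrite (eq_bigr (fun i : 'I_s.+1 => 'C(r, i) * (sg (i + l) * pi (t - i)))) => [|i _]; last by rewrite mulnA.
  rewrite -(@sum_subset_card _ (S :&: T) _ (fun i => sg (i + l) * pi (t - i))) //.
  apply: leq_sum => Y YR.
  have YZT : Y :|: Z \subset T by rewrite subUset ZT (subset_trans YR) ?subsetIr.
  by rewrite cardsDS // dis // leq_mul // pih //; lia.
have E4 : \sum_(Y : {set C} | Y \subset S :&: T) sg #|Y :|: Z| * pi #|S :\: (Y :|: Z)| =
    \sum_(i < s.+1) 'C(r, i) * sg (i + l) * pi (s - i).
  rewrite [RHS](eq_bigr (fun i : 'I_s.+1 => 'C(r, i) * (sg (i + l) * pi (s - i)))) => [|i _]; last by rewrite mulnA.
  rewrite -(@sum_subset_card _ (S :&: T) _ (fun i => sg (i + l) * pi (s - i))) //.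
  apply: eq_bigr => Y YR; rewrite dis // setDUr (setDidPl (_ : [disjoint S & Z])) 1?disjoint_sym //.
  have YS : Y \subset S by rewrite (subset_trans YR) ?subsetIl.
  by rewrite (setIidPl (subsetDl _ _)) cardsDS.
rewrite E1 E4; apply: leq_trans (leq_mul (leqnn _) E3) _.
apply: leq_trans (leq_mul E2 (leqnn _)); rewrite mulnC [leqRHS]mulnC.
(* The weight ratio decreases in i by [bin_ratio] and log-concavity of [sg]; the condition on the
   values is log-concavity of [pi]. *)
apply: (@chebyshev_sum _ (fun i => 'C(r, i) * sg (i + l)) (fun i => 'C(s, i) * sg i)
  (fun i => pi (s - i)) (fun i => pi (t - i))) => j i /andP[ji iB].
  have := bin_ratio rs (ltnW ji).
  have := @log_concave_spread _ j (i - j) l sgc; rewrite subnKC ?(ltnW ji) // => H1 H2.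
  by have := leq_mul H1 H2; lia.
have := @log_concave_spread _ (s - i) (t - s) (i - j) pic.
have -> : s - i + (t - s) + (i - j) = t - j by lia.
have -> : s - i + (t - s) = t - i by lia.
by have -> : s - i + (i - j) = s - j by lia.
Qed.

(** * Adding the parts of a multipartite graph one at a time *)

Section Multipartite.
Variables (V : finType) (c : V -> nat) (C : finType).
Hypothesis C_gt0 : 0 < #|C|.
Implicit Types (ks : seq nat) (S T : {set C}).

Definition partial_ok (D : finType) (R : rel D) ks (A : {set D}) (p : {ffun V -> D}) :=
  [forall u, (c u \in ks) ==> (p u \in A)] &&
  [forall u, forall v, [&& c u \in ks, c v \in ks & c u != c v] ==> R (p u) (p v)].

Definition part k := {v : V | c v == k}.

(** The new part is edgeless, so [r] meets only its list; its effect on the other parts is to shrink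
    their common list. *)
Lemma partial_ok_patch (D : finType) (R : rel D) k ks (A : {set D}) p (r : {ffun part k -> D}) :
  symmetric R -> k \notin ks ->
  partial_ok R (k :: ks) A (patch val p r) =
  [forall x, r x \in A] &&
    partial_ok R ks [set d in A | [forall x, R (r x) d]] p.
Proof.
move=> Rs kks; set P := patch _ _ _.
have Pin x : P (val x) = r x by exact: (patch_in val_inj).
have cval (x : part k) : c (val x) = k by apply/eqP; exact: (valP x).
have Pout u : c u != k -> P u = p u.
  by move=> uk; apply: patch_out => x; apply: contraNneq uk => <-; rewrite cval.
have vcase u : c u != k \/ exists x : part k, u = val x.
  by have [cu|] := boolP (c u == k); [right; exists (exist _ u cu)|left].
have ksk u : c u \in ks -> c u != k by apply: contraTneq => ->.
apply/idP/idP.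
  move=> /andP[/forallP H1 /forallP H2]; apply/and3P; split.
  - by apply/forallP => x; rewrite -Pin (implyP (H1 _)) // cval mem_head.
  - apply/forallP => u; apply/implyP => uks; rewrite inE -Pout ?ksk // (implyP (H1 _)) ?inE ?uks ?orbT //=.
    apply/forallP => x; rewrite -Pin (implyP (forallP (H2 _) _)) // cval mem_head inE uks orbT eq_sym.
    exact: ksk.
  - apply/forallP => u; apply/forallP => v; apply/implyP => /and3P[uks vks uv].
    by rewrite -!Pout ?ksk // (implyP (forallP (H2 _) _)) // !inE uks vks uv !orbT.
move=> /and3P[/forallP H1 /forallP H2 /forallP H3].
have out u : c u \in k :: ks -> c u != k -> c u \in ks by rewrite inE => /orP[->|].
have free u x : c u \in ks -> R (r x) (p u).
  by move=> uks; have := implyP (H2 u) uks; rewrite inE => /andP[_ /forallP].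
apply/andP; split; apply/forallP => u.
  apply/implyP => uks; have [uk|[x ->]] := vcase u; last by rewrite Pin.
  by have := implyP (H2 u) (out _ uks uk); rewrite inE Pout // => /andP[].
apply/forallP => v; apply/implyP => /and3P[uks vks uv].
have [uk|[x ux]] := vcase u; have [vk|[y vy]] := vcase v.
- by rewrite !Pout // (implyP (forallP (H3 _) _)) // uv !out.
- by rewrite vy Pin Pout // Rs free ?out.
- by rewrite ux Pin Pout // free ?out.
- by move: uv; rewrite ux vy !cval eqxx.
Qed.

Definition partial_count (D : finType) (R : rel D) ks A := \sum_p partial_ok R ks A p.

Lemma partial_count_cons (D : finType) (R : rel D) k ks (A : {set D}) :
  symmetric R -> k \notin ks ->
  #|{ffun part k -> D}| * partial_count R (k :: ks) A =
  \sum_(r : {ffun part k -> D}) [forall x, r x \in A] *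
    partial_count R ks [set d in A | [forall x, R (r x) d]].
Proof.
move=> Rs kks; rewrite -(sum_patch val_inj) exchange_big /=; apply: eq_bigr => r _.
rewrite big_distrr /=; apply: eq_bigr => p _.
by rewrite partial_ok_patch // mulnb.
Qed.

Local Notation Q ks S := (partial_count (fun x y : C => x != y) ks S).
Local Notation N ks S T := (partial_count (@crossed C) ks (setX S T)).

Lemma image_subset (W : finType) (f : {ffun W -> C}) S :
  [forall x, f x \in S] = ([set f x | x : W] \subset S).
Proof.
apply/forallP/subsetP => [H y /imsetP[x _ ->] //|H x].
exact: H (imset_f _ _).
Qed.

Lemma proper_count_cons k ks S : k \notin ks ->
  #|{ffun part k -> C}| * Q (k :: ks) S =
  \sum_(X : {set C} | X \subset S) surj #|{: part k}| #|X| * Q ks (S :\: X).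
Proof.
move=> kks; rewrite partial_count_cons //; last exact: neq_sym.
rewrite [RHS]big_mkcond /=.
pose G (X : {set C}) := (X \subset S) * Q ks (S :\: X).
rewrite (eq_bigr (fun r : {ffun part k -> C} => G [set r x | x : part k])) => [|r _].
  rewrite sum_ffun_image /G; apply: eq_bigr => X _.
  by case: (X \subset S); rewrite ?mul1n // mul0n muln0.
rewrite image_subset /G; congr (_ * partial_count _ _ _); apply/setP => d.
rewrite !inE andbC; congr andb; apply/forallP/negP => [H /imsetP[x _ dx]|H x].
  by have := H x; rewrite dx eqxx.
by apply/negP => /eqP dx; apply: H; rewrite -dx imset_f.
Qed.

(** If the two coordinates on the new part have images X and Y, later pairs avoid Y first and X
    second, so the remaining list is again a product. *)
Lemma crossed_count_cons k ks S T : k \notin ks ->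
  #|{ffun part k -> C}| ^ 2 * N (k :: ks) S T =
  \sum_(X : {set C} | X \subset S) \sum_(Y : {set C} | Y \subset T)
    surj #|{: part k}| #|X| * (surj #|{: part k}| #|Y| * N ks (S :\: Y) (T :\: X)).
Proof.
move=> kks.
have -> : #|{ffun part k -> C}| ^ 2 = #|{ffun part k -> C * C}|.
  by rewrite !card_ffun card_prod -expnM mulnC expnM -mulnn.
rewrite partial_count_cons //; last exact: crossed_sym.
rewrite sum_ffun_pair.
pose H (X Y : {set C}) := (X \subset S) * (Y \subset T) * N ks (S :\: Y) (T :\: X).
pose G (X : {set C}) := \sum_(Y : {set C}) surj #|{: part k}| #|Y| * H X Y.
transitivity (\sum_(f : {ffun part k -> C}) G [set f x | x : part k]).
  apply: eq_bigr => f _; rewrite /G -sum_ffun_image /H; apply: eq_bigr => g _.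
  rewrite -!image_subset mulnb; congr (_ * _); [congr nat_of_bool|congr (partial_count _ _ _)].
    apply/forallP/andP => [HA|[/forallP H1 /forallP H2] x].
      by split; apply/forallP => x; have := HA x; rewrite ffunE inE => /andP[].
    by rewrite ffunE inE H1 H2.
  apply/setP => -[a b]; rewrite !inE /=.
  have -> : [forall x, crossed ([ffun v => (f v, g v)] x) (a, b)] =
      (a \notin [set g x | x : part k]) && (b \notin [set f x | x : part k]).
    apply/forallP/andP => [HA|[ga fb] x].
      by split; apply/negP => /imsetP[x _ E]; have := HA x; rewrite ffunE /crossed /= E eqxx ?andbF.
    rewrite ffunE /crossed /=; apply/andP; split.
      by apply: contraNneq fb => <-; rewrite imset_f.
    by apply: contraNneq ga => <-; rewrite imset_f.
  by case: (a \in S); case: (b \in T); rewrite /= ?andbF ?andbT.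
rewrite sum_ffun_image [RHS]big_mkcond /G /H /=; apply: eq_bigr => X _.
case: (X \subset S); last by rewrite big1 ?muln0 // => Y _; rewrite mul0n muln0.
rewrite -big_distrr /=; congr (_ * _); rewrite [RHS]big_mkcond; apply: eq_bigr => Y _.
by case: (Y \subset T); rewrite ?mul1n // mul0n muln0.
Qed.

(* The factor [K] accounts for the vertices outside the parts in [ks], whose
   colours are unconstrained. *)
Lemma proper_count_log_concave ks : uniq ks ->
  exists (K : nat) (pi : nat -> nat), [/\ 0 < K, log_concave pi, {homo pi : i j / i <= j} &
    forall S, K * Q ks S = pi #|S|].
Proof.
elim: ks => [_|k ks IH /andP[kks /IH [K [pi [K0 pic pih HK]]]]].
  exists 1, (fun=> #|{ffun V -> C}|); split=> // S.
  rewrite mul1n /partial_count -sum1_card; apply: eq_bigr => p _.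
  by apply/eqP; rewrite eqb1; apply/andP; split; apply/forallP => u //; apply/forallP.
(* An image X of the new part leaves |S| - |X| colours, whence a binomial convolution with
   [surj]. *)
exists (K * #|{ffun part k -> C}|), (fun n => binconv n (surj #|{: part k}|) pi); split.
- by rewrite muln_gt0 K0 card_ffun expn_gt0 C_gt0.
- by apply: log_concave_binconv => //; exact: log_concave_surj.
- exact: homo_binconv.
move=> S; rewrite -mulnA proper_count_cons // big_distrr /= /binconv.
rewrite (eq_bigr (fun X : {set C} => surj #|{: part k}| #|X| * pi (#|S| - #|X|))) => [|X XS].
  rewrite (sum_subset_card (fun i => surj #|{: part k}| i * pi (#|S| - i)) (ltnSn _)).
  by apply: eq_bigr => i _; rewrite mulnA.
by rewrite mulnCA HK cardsDS.
Qed.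

(** [join_lists_ineq] exchanges the lists seen by the remaining parts, producing for each X and Y
    the lists S minus Y and T minus X of [crossed_count_cons]; the induction hypothesis applies to
    these. *)
Lemma partial_list_tensor_ineq ks S T : uniq ks -> Q ks S * Q ks T <= N ks S T.
Proof.
elim: ks S T => [|k ks IH] S T /=.
  move=> _; rewrite /partial_count sum_ffun_pair big_distrlr /=; apply: leq_sum => f _.
  apply: leq_sum => g _; rewrite mulnb (_ : partial_ok (@crossed C) _ _ _ = true) ?leq_b1 //.
  by rewrite /partial_ok; apply/andP; split; apply/forallP => u //; apply/forallP.
move=> /andP[kks ks_uniq]; have [K [pi [K0 pic pih HK]]] := proper_count_log_concave ks_uniq.
set L := #|{ffun part k -> C}|; set sg := surj #|{: part k}|.
have L0 : 0 < L by rewrite /L card_ffun expn_gt0 C_gt0.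
have KL0 : 0 < K ^ 2 * L ^ 2 by rewrite muln_gt0 !expn_gt0 K0 L0.
rewrite -(leq_pmul2l KL0) -[leqRHS]mulnA crossed_count_cons //.
have KQ U : K * L * Q (k :: ks) U = \sum_(X : {set C} | X \subset U) sg #|X| * pi #|U :\: X|.
  rewrite -mulnA proper_count_cons // big_distrr; apply: eq_bigr => X _ /=.
  by rewrite mulnCA HK.
have -> : K ^ 2 * L ^ 2 * (Q (k :: ks) S * Q (k :: ks) T) =
    (K * L * Q (k :: ks) S) * (K * L * Q (k :: ks) T) by lia.
rewrite !KQ; apply: leq_trans (join_lists_ineq S T (@log_concave_surj _) pic pih) _.
rewrite big_distrlr big_distrr /=; apply: leq_sum => X _.
rewrite big_distrr /=; apply: leq_sum => Y _.
rewrite -!HK -/sg; have := IH (S :\: Y) (T :\: X) ks_uniq.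
move: (Q ks (S :\: Y)) (Q ks (T :\: X)) (N ks _ _) => x y z xy.
apply: leq_trans (_ : K ^ 2 * (sg #|X| * sg #|Y|) * (x * y) <= _); first lia.
by apply: leq_trans (leq_mul (leqnn _) xy) _; lia.
Qed.
End Multipartite.

Lemma multipartite_list_tensor_ineq (G : graph) :
  complete_multipartite G -> list_tensor_ineq (gadj G).
Proof.
(* Without colours the nonempty graph has no colouring. *)
move=> [V0 [c cE]] C S T; have [C0|C0] := posnP #|C|.
  rewrite {1}/count_col big1 // => f _; have /card_gt0P [v _] := V0.
  by have := fintype0 (f v) C0.
pose ks := undup [seq c v | v : gV G].
have cks u : c u \in ks by rewrite mem_undup map_f ?mem_enum.
have E (D : finType) (R : rel D) (A : {set D}) p :
    partial_ok c R ks A p = [forall u, p u \in A] &&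
    [forall u, forall v, gadj G u v ==> R (p u) (p v)].
  rewrite /partial_ok; congr andb; first by apply: eq_forallb => u; rewrite cks.
  by apply: eq_forallb => u; apply: eq_forallb => v; rewrite !cks cE.
have := partial_list_tensor_ineq c C0 S T (undup_uniq _ : uniq ks).
rewrite /partial_count /count_col /count_crossed /proper_in /crossed_in.
under eq_bigr => p _ do rewrite E.
under [X in _ * X <= _ -> _]eq_bigr => p _ do rewrite E.
by under [X in _ <= X -> _]eq_bigr => p _ do rewrite E.
Qed.

Theorem theorem1p4 (F : graph) (Hs : gV F -> graph) (q : nat) :
  simple F -> bipartite F -> (forall i, in_classH (Hs i)) -> 2 <= q ->
  hom (blowup Hs) (K q) ^ 2 <= hom (tensorK2 (blowup Hs)) (K q).
Proof.
move=> _ bF HH /ltnW q0; apply: blowup_tensor_ineq => // i.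
case: (HH i) => [|[[m [m2]]|[n [n1]]]]; first exact: multipartite_list_tensor_ineq.
  move=> /list_tensor_ineq_iso; apply; case: m m2 => // m _.
  exact: cycle_list_tensor_ineq.
by move=> /list_tensor_ineq_iso; apply; exact: path_list_tensor_ineq.
Qed.
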